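(* Any boundary point reached by a martingale $Z$ bounded in $[0,1]$ is absorbing. More precisely, let $Z=(Z_t)_{t\ge0}$ be a martingale taking values in $[0,1]$, let $b\in\{0,1\}$ and $\tau_b:=\inf\{t\ge0:Z_t=b\}$. Then, on $\{\tau_b<\infty\}$, almost surely $Z_t=b$ for all $t\ge\tau_b$. Moreover, if $Z$ is a time-homogeneous diffusion with coefficient $\sigma(Z_t)$, i.e. $dZ_t=\sigma(Z_t)\,dW_t$ with $W$ a Brownian motion, and the boundary point $b$ is reached by $Z$ (that is, $\mathbb{P}(\tau_b<\infty)>0$), then $\sigma(b)=0$.
   Context: Martingales are with respect to a filtration satisfying the usual conditions and are taken with right-continuous paths (solutions of the SDE have continuous paths). *)

(* Defs.v *)
From mathcomp Require Import all_boot all_order all_algebra.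
From mathcomp Require Import all_classical all_reals all_analysis.
Set Implicit Arguments.
Unset Strict Implicit.
Unset Printing Implicit Defensive.
Import Order.TTheory GRing.Theory Num.Theory.
Import numFieldNormedType.Exports.
Local Open Scope classical_set_scope.
Local Open Scope ring_scope.

(* Time ranges over [0, +oo[.  Processes and filtrations are indexed by all of
   R, but every definition below only looks at nonnegative times. *)

Section processes.
Context d (T : measurableType d) (R : realType) (P : probability T R).

Implicit Types (F : R -> set (set T)) (X Z W H I : R -> T -> R).

Record usual_filtration F : Prop := {
  filtration_sigma_algebra : forall t : R, 0 <= t -> sigma_algebra setT (F t) ;
  filtration_measurable : forall t : R, 0 <= t -> F t `<=` measurable ;
  filtration_nondecreasing : forall s t : R, 0 <= s -> s <= t -> F s `<=` F t ;
  filtration_complete : forall N, P.-negligible N -> F 0 N ;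
  filtration_right_continuous : forall t : R, 0 <= t ->
    \bigcap_(s in `]t, +oo[) F s = F t }.

(* The measurable sets of [g_sigma_algebraType G] are those of the
   sigma-algebra generated by G, that is G itself when G is a sigma-algebra. *)
Definition measurable_wrt (G : set (set T)) (f : T -> R) :=
  measurable_fun [set: g_sigma_algebraType G] f.

Definition adapted F X := forall t : R, 0 <= t -> measurable_wrt (F t) (X t).

(* For every t, (s, w) |-> X s w is B([0, t]) (x) F_t measurable on [0, t] x T *)
Definition progressively_measurable F X := forall t : R, 0 <= t ->
  measurable_fun (`[0, t] `*` [set: g_sigma_algebraType (F t)])
    (fun p : R * g_sigma_algebraType (F t) => X p.1 p.2).

Definition right_continuous_paths X := forall (w : T) (t : R), 0 <= t ->
  X s w @[s --> t^'+] --> X t w.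

Definition continuous_paths X := forall w,
  {within `[0, +oo[, continuous (fun t => X t w)}.

(* Y is a version of the conditional expectation E[X | G] *)
Definition is_condexp (G : set (set T)) (X Y : T -> R) :=
  [/\ measurable_wrt G Y, P.-integrable setT (EFin \o Y) &
    forall A, G A -> (\int[P]_(w in A) (Y w)%:E = \int[P]_(w in A) (X w)%:E)%E].

Record martingale F Z : Prop := {
  martingale_adapted : adapted F Z ;
  martingale_integrable : forall t : R, 0 <= t -> P.-integrable setT (EFin \o Z t) ;
  martingale_condexp : forall s t : R, 0 <= s -> s <= t ->
    is_condexp (F s) (Z t) (Z s) ;
  martingale_right_continuous : right_continuous_paths Z }.

(* inf {t >= 0 : Z_t = b}, equal to +oo if b is never reached *)
Definition hitting_time Z (b : R) (w : T) : \bar R :=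
  ereal_inf [set t%:E | t in [set t : R | 0 <= t /\ Z t w = b]].

Definition increment W (s t : R) (w : T) : R := W t w - W s w.

Record brownian_motion F W : Prop := {
  brownian_start : {ae P, forall w, W 0 w = 0} ;
  brownian_adapted : adapted F W ;
  brownian_continuous : continuous_paths W ;
  brownian_independent : forall s t : R, 0 <= s -> s < t -> forall A B, F s A ->
    measurable B ->
    P (A `&` increment W s t @^-1` B) = (P A * P (increment W s t @^-1` B))%E ;
  (* the second parameter of normal_prob is the standard deviation *)
  brownian_gaussian : forall s t : R, 0 <= s -> s < t -> forall B, measurable B ->
    P (increment W s t @^-1` B) = normal_prob 0 (Num.sqrt (t - s)) B }.

(* Encodes the process sum_(i < n) xi_i 1_]t_i, t_(i+1)] *)
Record simple_process := SimpleProcess {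
  sp_size : nat ;
  sp_time : nat -> R ;
  sp_coef : nat -> T -> R }.

Record simple_predictable F (S : simple_process) : Prop := {
  simple_time0 : 0 <= sp_time S 0 ;
  simple_time_nondecreasing : {homo sp_time S : i j / (i <= j)%N >-> i <= j} ;
  simple_coef_measurable : forall i, (i < sp_size S)%N ->
    measurable_wrt (F (sp_time S i)) (sp_coef S i) ;
  simple_coef_bounded : exists M : R, forall i w, (i < sp_size S)%N ->
    `|sp_coef S i w| <= M }.

Definition sp_value (S : simple_process) (t : R) (w : T) : R :=
  \sum_(i < sp_size S)
    sp_coef S i w * \1_(`]sp_time S i, sp_time S i.+1]) t.

Definition sp_integral (S : simple_process) W (t : R) (w : T) : R :=
  \sum_(i < sp_size S) sp_coef S i w *
    (W (Num.min (sp_time S i.+1) t) w - W (Num.min (sp_time S i) t) w).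

Definition sq_time_integral H (t : R) (w : T) : \bar R :=
  (\int[lebesgue_measure]_(s in `[0%R, t]) ((H s w) ^+ 2)%:E)%E.

(* Convergence in probability to 0 of [0, +oo]-valued variables *)
Definition cvg_prob0 (Y : nat -> T -> \bar R) := forall e : R, 0 < e ->
  P [set w | (e%:E < Y n w)%E] @[n --> \oo] --> (0 : \bar R)%E.

(* I is (a continuous version of) the Ito integral of H against W: H is
   progressive, locally square integrable, and I is the limit in probability
   of integrals of simple processes converging to H. *)
Record is_ito_integral F W H I : Prop := {
  ito_progressive : progressively_measurable F H ;
  ito_square_integrable : forall t : R, 0 <= t ->
    {ae P, forall w, (sq_time_integral H t w < +oo)%E} ;
  ito_adapted : adapted F I ;
  ito_continuous : continuous_paths I ;
  ito_approximation : exists S : nat -> simple_process,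
    [/\ forall n, simple_predictable F (S n),
        forall t : R, 0 <= t -> cvg_prob0 (fun n =>
          sq_time_integral (fun s w => sp_value (S n) s w - H s w) t) &
        forall t : R, 0 <= t -> cvg_prob0 (fun n w =>
          `|sp_integral (S n) W t w - I t w|%:E)] }.

(* dZ_t = sigma(Z_t) dW_t, that is Z_t = Z_0 + int_0^t sigma(Z_s) dW_s *)
Definition solves_sde F W (sigma : R -> R) Z :=
  [/\ adapted F Z, continuous_paths Z &
    is_ito_integral F W (fun t w => sigma (Z t w))
      (fun t w => Z t w - Z 0 w)].

End processes.

(* Main.v *)
From HB Require Import structures.
Require Import Defs.
From mathcomp Require Import all_boot all_order all_algebra.
From mathcomp Require Import all_classical all_reals all_analysis.
From mathcomp Require Import measurable_realfun.
From mathcomp Require Import ring lra.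
Set Implicit Arguments.
Unset Strict Implicit.
Unset Printing Implicit Defensive.
Import Order.TTheory GRing.Theory Num.Theory.
Import numFieldNormedType.Exports.
Local Open Scope classical_set_scope.
Local Open Scope ring_scope.

(** A nonnegative martingale that comes close to 0 at some time before q is
    small on average at time q: the discrete maximal inequality
    [integral_low] bounds the integral of Z_q over the event that Z falls below
    e on a finite grid by e. By right-continuity, a path that vanishes before q
    is below e at points of every fine enough grid, for every e; hence almost
    surely Z_q = 0 at every rational q after a zero, and right-continuity
    extends this to all later times ([zero_absorbing]). The boundary point 1 is
    reduced to 0 by passing to 1 - Z.

    If the path solves dZ = sigma(Z) dW and b is reached with positive
    probability, then for some integer s the event A on which Z_s = b and Z has
    been absorbed at b is F_s-measurable and has positive probability. On A the
    integrand sigma(Z_r) is constantly sigma b for r >= s, so that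
    0 = Z_(s+1) - Z_s = sigma b * (W_(s+1) - W_s) almost surely on A
    ([ito_integral_constant]). The increment of W is independent of A and its
    law has no atom, so sigma b = 0.

    The identity on A rests on one estimate for integrals of simple processes:
    if g is adapted and piecewise constant, then
      P(|int g dW| > e) <= 8 dl / e^2 + P(int g^2 dt > dl)
    ([elementary_integral_tail]). It is applied to g = 1_A (S_n - sigma b) on
    ]s, s+1], where the S_n are simple processes approximating the integrand.
    The estimate follows from the L2 bound E[(int g dW)^2] <= 8 E[int g^2 dt]
    after truncating g as soon as its accumulated energy exceeds dl. An
    inequality with some universal constant is enough here in place of the Ito
    isometry, so that the variance of the normal law need only be bounded. *)

(** * Moments of the centered normal law *)

Section normal_moments.
Context {R : realType}.
Local Notation mu := (@lebesgue_measure R).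
Implicit Types (m s : R) (f : R -> \bar R).

(** The Radon-Nikodym derivative of the normal law agrees almost everywhere
    with the density, because both integrate to the law on measurable sets. *)
Lemma ge0_integral_normal_prob m s f :
  measurable_fun [set: R] f -> (forall x, 0 <= f x)%E ->
  (\int[normal_prob m s]_x f x = \int[mu]_x (f x * (normal_pdf m s x)%:E))%E.
Proof.
move=> mf f0.
have dom := @normal_prob_dominates R m s.
rewrite -(Radon_Nikodym_SigmaFinite.change_of_variables dom)//.
have mrn := measurable_int _ (Radon_Nikodym_SigmaFinite.f_integrable dom).
have mpdf : measurable_fun [set: R] (EFin \o normal_pdf m s).
  by apply/measurable_EFinP; exact: measurable_normal_pdf.
apply: ae_eq_integral => //; [exact: emeasurable_funM|exact: emeasurable_funM|].
apply: ae_eqe_mul2l; apply: integral_ae_eq => //.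
  exact: Radon_Nikodym_SigmaFinite.f_integrable.
by move=> E _ mE; rewrite -Radon_Nikodym_SigmaFinite.f_integral.
Qed.

Lemma ge0_integral_lebesgueN f :
  measurable_fun [set: R] f -> (forall x, 0 <= f x)%E ->
  (\int[mu]_x f (- x)%R = \int[mu]_x f x)%E.
Proof.
move=> mf f0.
rewrite -[LHS](@ge0_integral_pushforward _ _ (measurableTypeR R) _ _
  (-%R : _ -> measurableTypeR R) _ mu setT f)//.
by apply: eq_measure_integral => A mA _; exact: lebesgue_measureN.
Qed.

Lemma normal_prob_symmetric s f : s != 0 ->
  measurable_fun [set: R] f -> (forall x, 0 <= f x)%E ->
  (\int[normal_prob 0 s]_x f (- x)%R = \int[normal_prob 0 s]_x f x)%E.
Proof.
move=> s0 mf f0; rewrite !ge0_integral_normal_prob//; last first.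
  exact: measurableT_comp.
rewrite -[RHS]ge0_integral_lebesgueN//; last 2 first.
- apply: emeasurable_funM => //; apply/measurable_EFinP.
  exact: measurable_normal_pdf.
- by move=> x; rewrite mule_ge0// lee_fin normal_pdf_ge0.
apply: eq_integral => x _; rewrite !normal_pdfE// /normal_fun.
by rewrite !subr0 sqrrN.
Qed.

(** The density of standard deviation s times x^2 is dominated by a multiple of
    the density of standard deviation sqrt 2 * s: with u = x^2 / (4 s^2), one
    of the two factors expR (- u) absorbs u. This avoids integrating by
    parts; the constant 8 is not optimal. *)
Lemma normal_prob_second_moment s : s != 0 ->
  (\int[normal_prob 0 s]_x (x ^+ 2)%:E <= (8 * s ^+ 2)%:E)%E.
Proof.
move=> s0.
rewrite ge0_integral_normal_prob//; last 2 first.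
- by apply/measurable_EFinP; exact: measurable_funX.
- by move=> x; rewrite lee_fin sqr_ge0.
set t := Num.sqrt 2 * s.
have t0 : t != 0 by rewrite mulf_neq0// sqrtr_eq0 -ltNge.
have t2 : t ^+ 2 = 2 * s ^+ 2 by rewrite exprMn sqr_sqrtr.
have peak : normal_peak s <= 2 * normal_peak t.
  rewrite /normal_peak t2; set a := s ^+ 2 * pi *+ 2.
  have a0 : 0 < a.
    by rewrite /a pmulrn_rgt0// mulr_gt0 ?pi_gt0// exprn_even_gt0.
  have -> : 2 * s ^+ 2 * pi *+ 2 = 2 * a by rewrite /a; ring.
  have sa0 : 0 < Num.sqrt a by rewrite sqrtr_gt0.
  rewrite -ler_pdivrMl// -invfM lef_pV2 ?posrE ?sqrtr_gt0 ?mulr_gt0//.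
  rewrite -[leRHS]ger0_norm ?mulr_ge0 ?(ltW sa0)// -sqrtr_sqr ler_sqrt ?sqr_ge0//.
  by rewrite exprMn sqr_sqrtr ?(ltW a0)// ler_pM2r// expr2; lra.
have bnd x : x ^+ 2 * normal_pdf 0 s x <= 8 * s ^+ 2 * normal_pdf 0 t x.
  rewrite !normal_pdfE// /normal_fun !subr0 t2.
  set u := x ^+ 2 / (4 * s ^+ 2).
  have s20 : s ^+ 2 != 0 by rewrite sqrf_eq0.
  have u0 : 0 <= u by rewrite divr_ge0 ?sqr_ge0// mulr_ge0// sqr_ge0.
  have -> : - x ^+ 2 / (s ^+ 2 *+ 2) = - u - u by rewrite /u; field.
  have -> : - x ^+ 2 / (2 * s ^+ 2 *+ 2) = - u by rewrite /u; field.
  have -> : x ^+ 2 = 4 * s ^+ 2 * u by rewrite /u; field.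
  rewrite expRD.
  have eu : u * expR (- u) <= 1.
    rewrite expRN ler_pdivrMr ?expR_gt0// mul1r.
    by apply: le_trans (expR_ge1Dx u); rewrite lerDr.
  have -> : 4 * s ^+ 2 * u * (normal_peak s * (expR (- u) * expR (- u))) =
            4 * s ^+ 2 * expR (- u) * (normal_peak s * (u * expR (- u))) by ring.
  have -> : 8 * s ^+ 2 * (normal_peak t * expR (- u)) =
            4 * s ^+ 2 * expR (- u) * (2 * normal_peak t) by ring.
  apply: ler_wpM2l; first by do 2?apply: mulr_ge0; rewrite ?sqr_ge0 ?expR_ge0.
  by apply: le_trans peak; rewrite ler_piMr// normal_peak_ge0.
have mpdf : measurable_fun [set: R] (EFin \o normal_pdf 0 t).
  by apply/measurable_EFinP; exact: measurable_normal_pdf.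
apply: (@le_trans _ _ (\int[mu]_x ((8 * s ^+ 2)%:E * (normal_pdf 0 t x)%:E))%E).
  apply: ge0_le_integral => //.
  - by move=> x _; rewrite -EFinM lee_fin mulr_ge0 ?sqr_ge0 ?normal_pdf_ge0.
  - apply/measurable_EFinP; apply: measurable_funM; first exact: measurable_funX.
    exact: measurable_normal_pdf.
  - exact: emeasurable_funM.
  - by move=> x _; rewrite -!EFinM lee_fin.
rewrite ge0_integralZl//; last 2 first.
- by move=> x _; rewrite lee_fin normal_pdf_ge0.
- by rewrite lee_fin mulr_ge0 ?sqr_ge0.
by rewrite integral_normal_pdf mule1.
Qed.

Lemma normal_prob_set1 s (x : R) : normal_prob 0 s [set x] = 0%E.
Proof.
have /null_content_dominatesP := @normal_prob_dominates R 0 s.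
apply => //; exact: lebesgue_measure_set1.
Qed.

End normal_moments.

(** * Products of independent random variables *)

Section independence.
Context d {T : measurableType d} {R : realType} (P : probability T R).
Variables X Y : {mfun T >-> R}.
Hypothesis XY : forall A B, measurable A -> measurable B ->
  P (X @^-1` A `&` Y @^-1` B) = (P (X @^-1` A) * P (Y @^-1` B))%E.

Let XYpair (w : T) : R * R := (X w, Y w).

Let measurable_XYpair : measurable_fun [set: T] XYpair.
Proof.
by apply/measurable_fun_pairP; split;
  [exact: (@measurable_funPT _ _ _ _ X)|exact: (@measurable_funPT _ _ _ _ Y)].
Qed.

Local Notation PX := (distribution P X).
Local Notation PY := (distribution P Y).

Let joint_law A : measurable A -> (PX \x PY)%E A = pushforward P XYpair A.
Proof.
move=> mA.
by apply: product_measure_unique => // B C mB mC; rewrite -XY.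
Qed.

Let ge0_integral_joint (f : R * R -> \bar R) :
  measurable_fun [set: R * R] f ->
  (forall z, 0 <= f z)%E ->
  (\int[P]_w f (X w, Y w) = \int[PX \x PY]_z f z)%E.
Proof.
move=> mf f0.
rewrite (eq_measure_integral (pushforward P XYpair)); last first.
  by move=> A mA _; exact: joint_law.
by rewrite ge0_integral_pushforward.
Qed.

(** By independence the joint law of (X, Y) is the product of the marginal
    laws, so Fubini's theorem applies. *)
Lemma indep_integrableM : P.-integrable setT (EFin \o X) ->
  P.-integrable setT (EFin \o Y) ->
  P.-integrable setT (fun w => (X w * Y w)%:E) /\
  (\int[P]_w (X w * Y w)%:E = \int[P]_w (X w)%:E * \int[P]_w (Y w)%:E)%E.
Proof.
move=> iX iY.
have mX : measurable_fun [set: R * R]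
  (fun z : R * R => z.1) by exact: measurable_fst.
have mY : measurable_fun [set: R * R]
  (fun z : R * R => z.2) by exact: measurable_snd.
have mXY : measurable_fun [set: R * R]
  (fun z : R * R => (z.1 * z.2)%:E).
  by apply/measurable_EFinP; exact: measurable_funM.
have mabs : measurable_fun [set: R] (fun x : R => `|x|%:E).
  by apply/measurable_EFinP; exact: normr_measurable.
have iPX : PX.-integrable setT (fun x : R => x%:E).
  apply/integrableP; split; first by apply/measurable_EFinP; exact: measurable_id.
  move/integrableP : iX => [_]; apply: le_lt_trans.
  by rewrite ge0_integral_distribution.
have iPY : PY.-integrable setT (fun x : R => x%:E).
  apply/integrableP; split; first by apply/measurable_EFinP; exact: measurable_id.
  move/integrableP : iY => [_]; apply: le_lt_trans.
  by rewrite ge0_integral_distribution.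
have iXY : (PX \x PY)%E.-integrable setT (fun z : R * R => (z.1 * z.2)%:E).
  apply/integrable12ltyP => //=.
  under eq_integral => x _.
    under eq_integral => y _ do rewrite normrM EFinM.
    rewrite ge0_integralZl//; over.
  rewrite ge0_integralZr//; last exact: integral_ge0.
  by apply: lte_mul_pinfty; [exact: integral_ge0|
    exact/integrable_fin_num/integrable_norm|move/integrableP : iPY => -[]].
have iM : P.-integrable setT (fun w => (X w * Y w)%:E).
  apply/integrableP; split.
    by apply/measurable_EFinP; exact: measurable_funM.
  move/integrableP : iXY => [_]; rewrite -ge0_integral_joint//.
  exact: measurableT_comp.
split=> //.
transitivity (\int[PX \x PY]_z (z.1 * z.2)%:E)%E.
  rewrite (eq_measure_integral (pushforward P XYpair)); last first.
    by move=> A mA _; exact: joint_law.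
  by rewrite integral_pushforward.
rewrite -integral12_prod_meas1//.
transitivity (\int[PX]_x (x%:E * \int[PY]_y y%:E))%E.
  apply: eq_integral => x _; rewrite /fubini_F/=.
  by under eq_integral do rewrite EFinM; rewrite integralZl.
have /fineK <- : (\int[PY]_y y%:E)%E \is a fin_num by exact: integrable_fin_num.
rewrite integralZr// fineK; last exact: integrable_fin_num.
by rewrite !integral_distribution.
Qed.

End independence.

Section square_integrable.
Context d {T : measurableType d} {R : realType}.

Lemma integrable_of_sqr (mu : {finite_measure set T -> \bar R}) (X : T -> R) :
  measurable_fun [set: T] X ->
  mu.-integrable setT (fun w => (X w ^+ 2)%:E) ->
  mu.-integrable setT (EFin \o X).
Proof.
move=> mX iX.
apply: (@le_integrable _ _ _ mu setT measurableT _ (fun w => (1 + X w ^+ 2)%:E)).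
- exact/measurable_EFinP.
- move=> w _ /=; rewrite lee_fin [leRHS]ger0_norm ?addr_ge0 ?sqr_ge0//.
  rewrite -(real_normK (num_real (X w))).
  by have := sqr_ge0 (`|X w| - 1); nra.
- under eq_fun do rewrite EFinD.
  by apply: integrableD => //; exact: finite_measure_integrable_cst.
Qed.

Lemma measurable_gt_set (X : T -> R) a : measurable_fun [set: T] X ->
  measurable [set w | a < X w].
Proof.
move=> mX; rewrite (_ : [set w | _] = X @^-1` `]a, +oo[).
  by rewrite -[_ @^-1` _]setTI; exact: mX.
by apply/seteqP; split=> w; rewrite /= in_itv/= andbT.
Qed.

Lemma measure_sqr_tail (mu : {measure set T -> \bar R}) (X : T -> R) (e : R) :
  0 < e -> measurable_fun [set: T] X ->
  (mu [set w | (e < `|X w|)%R] <= (e ^- 2)%:E * \int[mu]_w (X w ^+ 2)%:E)%E.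
Proof.
move=> e0 mX.
have mX2 : measurable_fun [set: T] (fun w => (X w ^+ 2)%:E).
  by apply/measurable_EFinP; exact: measurable_funX.
have e20 : 0 < e ^+ 2 by rewrite exprn_gt0.
rewrite muleC lee_pdivlMr// muleC.
have := le_integral_abse mu measurableT mX2 e20.
under eq_integral do rewrite gee0_abs ?lee_fin ?sqr_ge0//.
apply: le_trans; apply: lee_wpmul2l; first by rewrite lee_fin ltW.
apply: le_measure; rewrite ?inE.
- by apply: measurable_gt_set; exact: measurableT_comp.
- by apply: emeasurable_fun_c_infty => //; exact: measurableT_comp.
- move=> w /= ew; split => //; rewrite lee_fin normrX.
  by rewrite lerXn2r ?nnegrE ?normr_ge0// ltW.
Qed.

End square_integrable.

(** * Measurability with respect to the filtration *)

Section filtration.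
Context d {T : measurableType d} {R : realType} {P : probability T R}.
Context {F : R -> set (set T)} (hF : usual_filtration P F).
Implicit Types (f : T -> R) (s t : R).

Lemma measurable_wrt_preimage t f B : 0 <= t -> measurable_wrt (F t) f ->
  measurable B -> F t (f @^-1` B).
Proof.
move=> t0 mf mB.
have := mf measurableT B mB; rewrite setTI.
by rewrite measurable_g_measurableTypeE//; exact: (filtration_sigma_algebra hF).
Qed.

Lemma measurable_wrt_le s t f : 0 <= s -> s <= t ->
  measurable_wrt (F s) f -> measurable_wrt (F t) f.
Proof.
move=> s0 st mf _ B mB; rewrite setTI.
have t0 := le_trans s0 st.
rewrite measurable_g_measurableTypeE//; last exact: (filtration_sigma_algebra hF).
apply: (filtration_nondecreasing hF s0 st).
exact: measurable_wrt_preimage.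
Qed.

Lemma measurable_wrt_measurable t f : 0 <= t ->
  measurable_wrt (F t) f -> measurable_fun [set: T] f.
Proof.
move=> t0 mf _ B mB; rewrite setTI.
by apply: (filtration_measurable hF t0); exact: measurable_wrt_preimage.
Qed.

Lemma measurable_wrt_indic t A : 0 <= t -> F t A ->
  measurable_wrt (F t) (\1_A : T -> R).
Proof.
move=> t0 FA; apply: measurable_indic.
by rewrite measurable_g_measurableTypeE//; exact: (filtration_sigma_algebra hF).
Qed.

End filtration.

(** * Brownian increments *)

Section brownian.
Context d {T : measurableType d} {R : realType} {P : probability T R}.
Context {F : R -> set (set T)} (hF : usual_filtration P F).
Context {W : R -> T -> R} (hW : brownian_motion P F W).
Implicit Types (s t : R).

Lemma measurable_brownian t : 0 <= t -> measurable_fun [set: T] (W t).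
Proof.
by move=> t0; apply: (measurable_wrt_measurable hF t0); exact: (brownian_adapted hW).
Qed.

Lemma measurable_increment s t : 0 <= s -> s < t ->
  measurable_fun [set: T] (increment W s t).
Proof.
move=> s0 st; apply: measurable_funB; apply: measurable_brownian => //.
by rewrite (le_trans s0)// ltW.
Qed.

Lemma ge0_integral_increment s t (f : R -> \bar R) : 0 <= s -> s < t ->
  measurable_fun [set: R] f -> (forall x, 0 <= f x)%E ->
  (\int[P]_w f (increment W s t w) =
   \int[normal_prob 0 (Num.sqrt (t - s))]_x f x)%E.
Proof.
move=> s0 st mf f0.
have mD := measurable_increment s0 st.
have mD' : measurable_fun [set: T] (increment W s t : T -> measurableTypeR R) by [].
pose D : {mfun T >-> measurableTypeR R} :=
  HB.pack (increment W s t : T -> measurableTypeR R)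
    (isMeasurableFun.Build _ _ _ _ _ mD').
rewrite -(ge0_integral_distribution (P := P) D mf f0).
apply: eq_measure_integral => A mA _.
exact: (brownian_gaussian hW).
Qed.

Lemma increment_second_moment s t : 0 <= s -> s < t ->
  (\int[P]_w (increment W s t w ^+ 2)%:E <= (8 * (t - s))%:E)%E.
Proof.
move=> s0 st.
rewrite (ge0_integral_increment (f := fun x => (x ^+ 2)%:E))//; last 2 first.
- by apply/measurable_EFinP; exact: measurable_funX.
- by move=> x; rewrite lee_fin sqr_ge0.
have st0 : 0 < t - s by rewrite subr_gt0.
apply: le_trans (normal_prob_second_moment _) _.
  by rewrite sqrtr_eq0 -ltNge.
by rewrite sqr_sqrtr// ltW.
Qed.

Lemma integrable_increment2 s t : 0 <= s -> s < t ->
  P.-integrable setT (fun w => (increment W s t w ^+ 2)%:E).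
Proof.
move=> s0 st; have mD := measurable_increment s0 st.
apply/integrableP; split.
  by apply/measurable_EFinP; exact: measurable_funX.
under eq_integral do rewrite gee0_abs ?lee_fin ?sqr_ge0//.
by apply: le_lt_trans (increment_second_moment s0 st) _; rewrite ltry.
Qed.

(** By symmetry of the normal law, the positive and negative parts of an
    increment have the same, finite, integral. *)
Lemma integral_increment s t : 0 <= s -> s < t ->
  (\int[P]_w (increment W s t w)%:E = 0)%E.
Proof.
move=> s0 st; have mD := measurable_increment s0 st.
have iD := integrable_of_sqr mD (integrable_increment2 s0 st).
rewrite integralE/=.
pose f (x : R) : \bar R := (Num.max x 0)%:E.
have mf : measurable_fun [set: R] f.
  by apply/measurable_EFinP; exact: measurable_maxr.
have f0 x : (0 <= f x)%E by rewrite lee_fin le_max lexx orbT.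
have Epos : (\int[P]_w (fun w => (increment W s t w)%:E)^\+ w =
  \int[P]_w f (increment W s t w))%E.
  by apply: eq_integral => w _; rewrite funeposE /f -EFin_max.
have -> : (\int[P]_w (fun w => (increment W s t w)%:E)^\- w =
  \int[P]_w f (- increment W s t w)%R)%E.
  by apply: eq_integral => w _; rewrite funenegE /f -EFinN -EFin_max.
rewrite (ge0_integral_increment (f := fun x => f (- x)))//; last first.
  exact: measurableT_comp.
rewrite normal_prob_symmetric//; last first.
  by rewrite sqrtr_eq0 -ltNge subr_gt0.
rewrite -ge0_integral_increment// Epos subee// -Epos.
exact: integrable_fin_num (integrable_funepos measurableT iD).
Qed.

Lemma integral_indep_increment s t (X : T -> R) : 0 <= s -> s < t ->
  measurable_wrt (F s) X ->
  P.-integrable setT (EFin \o X) ->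
  P.-integrable setT (fun w => (X w * increment W s t w)%:E) /\
  (\int[P]_w (X w * increment W s t w)%:E = 0)%E.
Proof.
move=> s0 st FX iX; have mD := measurable_increment s0 st.
pose X' : {mfun T >-> R} :=
  HB.pack X (isMeasurableFun.Build _ _ _ _ _ (measurable_wrt_measurable hF s0 FX)).
pose D : {mfun T >-> R} :=
  HB.pack (increment W s t) (isMeasurableFun.Build _ _ _ _ _ mD).
have [|||? E] := @indep_integrableM _ _ _ P X' D.
- move=> A B mA mB; apply: (brownian_independent hW) => //.
  exact: (measurable_wrt_preimage hF).
- by [].
- by apply: integrable_of_sqr => //; exact: integrable_increment2.
- by split=> //; rewrite E/= integral_increment// mule0.
Qed.

Lemma integral_indep_sqr_increment s t (X : T -> R) : 0 <= s -> s < t ->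
  measurable_wrt (F s) X ->
  P.-integrable setT (EFin \o X) ->
  P.-integrable setT (fun w => (X w * increment W s t w ^+ 2)%:E) /\
  (\int[P]_w (X w * increment W s t w ^+ 2)%:E =
   \int[P]_w (X w)%:E * \int[P]_w (increment W s t w ^+ 2)%:E)%E.
Proof.
move=> s0 st FX iX; have mD := measurable_increment s0 st.
have mD2 : measurable_fun [set: T] (fun w => increment W s t w ^+ 2).
  exact: measurable_funX.
pose X' : {mfun T >-> R} :=
  HB.pack X (isMeasurableFun.Build _ _ _ _ _ (measurable_wrt_measurable hF s0 FX)).
pose D : {mfun T >-> R} :=
  HB.pack (fun w => increment W s t w ^+ 2) (isMeasurableFun.Build _ _ _ _ _ mD2).
have [|||? E] := @indep_integrableM _ _ _ P X' D.
- move=> A B mA mB.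
  rewrite (_ : D @^-1` B = increment W s t @^-1` ((fun x => x ^+ 2) @^-1` B))//.
  apply: (brownian_independent hW) => //.
    exact: (measurable_wrt_preimage hF).
  by rewrite -[_ @^-1` _]setTI; exact: exprn_measurable.
- by [].
- exact: integrable_increment2.
- by split.
Qed.

End brownian.

(** * Integrals of elementary processes *)

Section elementary_integral_def.
Context {T : Type} {R : realType}.

Definition elementary_integral (W : R -> T -> R) (v : nat -> R)
    (g : nat -> T -> R) m w :=
  \sum_(i < m) g i w * (W (v i.+1) w - W (v i) w).

Definition elementary_energy (v : nat -> R) (g : nat -> T -> R) m w :=
  \sum_(i < m) g i w ^+ 2 * (v i.+1 - v i).

Lemma elementary_energy_ge0 v g m w :
  {homo v : i j / (i <= j)%N >-> i <= j} -> 0 <= elementary_energy v g m w.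
Proof.
move=> hv; apply: sumr_ge0 => i _.
by rewrite mulr_ge0 ?sqr_ge0// subr_ge0 hv.
Qed.

End elementary_integral_def.

Section elementary_integral.
Context d {T : measurableType d} {R : realType} {P : probability T R}.
Context {F : R -> set (set T)} (hF : usual_filtration P F).
Context {W : R -> T -> R} (hW : brownian_motion P F W).

Section fixed_partition.
Variables (v : nat -> R) (hv0 : 0 <= v 0) (hv : {homo v : i j / (i <= j)%N >-> i <= j}).

Let v_ge0 i : 0 <= v i.
Proof. by rewrite (le_trans hv0)// hv. Qed.

Lemma measurable_wrt_elementary_energy g m :
  (forall i, (i <= m)%N -> measurable_wrt (F (v i)) (g i)) ->
  measurable_wrt (F (v m)) (elementary_energy v g m.+1).
Proof.
move=> hg; apply: measurable_sum => i.
have im : (i <= m)%N by rewrite -ltnS.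
apply: measurable_funM => //; apply: measurable_funX.
by apply: (measurable_wrt_le hF _ (hv im)) => //; exact: hg.
Qed.

Lemma measurable_wrt_elementary_integral g m :
  (forall i, (i < m)%N -> measurable_wrt (F (v i)) (g i)) ->
  measurable_wrt (F (v m)) (elementary_integral W v g m).
Proof.
move=> hg; apply: measurable_sum => i.
apply: measurable_funM.
  by apply: (measurable_wrt_le hF _ (hv (ltnW (ltn_ord i)))) => //; exact: hg.
apply: measurable_funB.
  apply: (measurable_wrt_le hF _ (hv (ltn_ord i))) => //.
  exact: (brownian_adapted hW).
apply: (measurable_wrt_le hF _ (hv (ltnW (ltn_ord i)))) => //.
exact: (brownian_adapted hW).
Qed.

(** Adding one step D = W_(v_(m+1)) - W_(v_m) with coefficient g to the integral
    M turns M^2 into M^2 + 2 (M g) D + g^2 D^2. As M g and g are known at time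
    v_m, the middle term has mean 0 and the last one factors. *)
Lemma elementary_integral_sqr g m K :
  (forall i, (i < m)%N -> measurable_wrt (F (v i)) (g i)) ->
  (forall i w, (i < m)%N -> `|g i w| <= K) ->
  P.-integrable setT (fun w => (elementary_integral W v g m w ^+ 2)%:E) /\
  (\int[P]_w (elementary_integral W v g m w ^+ 2)%:E <=
   8%:E * \int[P]_w (elementary_energy v g m w)%:E)%E.
Proof.
elim: m => [|m IH] hg hK.
  have E0 w : elementary_integral W v g 0 w ^+ 2 = 0.
    by rewrite /elementary_integral big_ord0 expr0n.
  under eq_fun do rewrite E0.
  split; first exact: integrable0.
  rewrite integral0 mule_ge0//; apply: integral_ge0 => w _.
  by rewrite lee_fin elementary_energy_ge0.
have {IH}[||iM bM] := IH.
- by move=> i im; apply: hg; rewrite ltnS ltnW.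
- by move=> i w im; apply: hK; rewrite ltnS ltnW.
set M := elementary_integral W v g m in iM bM.
have EM w : elementary_integral W v g m.+1 w =
    M w + g m w * increment W (v m) (v m.+1) w.
  by rewrite /elementary_integral big_ord_recr.
have Een w : elementary_energy v g m.+1 w =
    elementary_energy v g m w + g m w ^+ 2 * (v m.+1 - v m).
  by rewrite /elementary_energy big_ord_recr.
(* Consecutive times may coincide; independence is only available for
   increments over intervals of positive length. *)
have := hv (leqnSn m); rewrite le_eqVlt => /predU1P[vE|vlt].
  under eq_fun do rewrite EM /increment -vE subrr mulr0 addr0.
  split => //; apply: le_trans bM _; rewrite le_eqVlt; apply/orP; left; apply/eqP.
  by congr (_ * _)%E; apply: eq_integral => w _; rewrite Een -vE subrr mulr0 addr0.
set D := increment W (v m) (v m.+1).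
have hgm := hg m (ltnSn m).
have mM : measurable_wrt (F (v m)) M.
  by apply: measurable_wrt_elementary_integral => i im; apply: hg; rewrite ltnS ltnW.
have mMT := measurable_wrt_measurable hF (v_ge0 m) mM.
have mgT := measurable_wrt_measurable hF (v_ge0 m) hgm.
have iM1 := integrable_of_sqr mMT iM.
have iMg : P.-integrable setT (EFin \o (fun w => M w * g m w)).
  apply: (@le_integrable _ _ _ P setT measurableT _ (fun w => K%:E * (M w)%:E)%E).
  - by apply/measurable_EFinP; exact: measurable_funM.
  - move=> w _ /=; rewrite lee_fin !normrM mulrC ler_wpM2r//.
    by apply: le_trans (hK _ _ (ltnSn m)) _; rewrite ler_norm.
  - exact: integrableZl.
have ig2 : P.-integrable setT (EFin \o (fun w => g m w ^+ 2)).
  apply: (@le_integrable _ _ _ P setT measurableT _ (fun w => (K ^+ 2)%:E)%E).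
  - by apply/measurable_EFinP; exact: measurable_funX.
  - move=> w _ /=; rewrite lee_fin !normrX lerXn2r ?nnegrE//.
    by apply: le_trans (hK _ _ (ltnSn m)) _; rewrite ler_norm.
  - exact: finite_measure_integrable_cst.
have [iMgD EMgD] :=
  integral_indep_increment hF hW (v_ge0 m) vlt (measurable_funM mM hgm) iMg.
have [ig2D Eg2D] :=
  integral_indep_sqr_increment hF hW (v_ge0 m) vlt (measurable_funX 2 hgm) ig2.
have EM2 w : (elementary_integral W v g m.+1 w ^+ 2)%:E =
    ((M w ^+ 2)%:E + 2%:E * (M w * g m w * D w)%:E + (g m w ^+ 2 * D w ^+ 2)%:E)%E.
  by rewrite -EFinM -!EFinD EM -/D; congr EFin; ring.
have i1 := integrableZl measurableT 2 iMgD.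
have i2 := integrableD measurableT iM i1.
split.
  under eq_fun do rewrite EM2.
  exact: integrableD.
under eq_integral do rewrite EM2.
rewrite integralD// integralD// integralZl//.
rewrite EMgD mule0 adde0 Eg2D.
have -> : (\int[P]_w (elementary_energy v g m.+1 w)%:E =
  \int[P]_w (elementary_energy v g m w)%:E +
  \int[P]_w (g m w ^+ 2)%:E * (v m.+1 - v m)%:E)%E.
  under eq_integral do rewrite Een EFinD.
  rewrite ge0_integralD//; last 4 first.
  - by move=> w _; rewrite lee_fin elementary_energy_ge0.
  - apply/measurable_EFinP; apply: measurable_sum => i; apply: measurable_funM => //.
    apply: measurable_funX.
    have im : (i < m.+1)%N by rewrite ltnS ltnW.
    exact: (measurable_wrt_measurable hF (v_ge0 i) (hg _ im)).
  - by move=> w _; rewrite lee_fin mulr_ge0 ?sqr_ge0// subr_ge0 ltW.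
  - by apply/measurable_EFinP; apply: measurable_funM => //; exact: measurable_funX.
  congr (_ + _)%E; rewrite -ge0_integralZr//.
  - by apply/measurable_EFinP; exact: measurable_funX.
  - by move=> w _; rewrite lee_fin sqr_ge0.
  - by rewrite lee_fin subr_ge0 ltW.
rewrite [leRHS]ge0_muleDr; last 2 first.
- by apply: integral_ge0 => w _; rewrite lee_fin elementary_energy_ge0.
- rewrite mule_ge0//; last by rewrite lee_fin subr_ge0 ltW.
  by apply: integral_ge0 => w _; rewrite lee_fin sqr_ge0.
rewrite leeD// muleCA; apply: lee_wpmul2l.
  by apply: integral_ge0 => w _; rewrite lee_fin sqr_ge0.
by rewrite -EFinM; exact: (increment_second_moment hF hW).
Qed.

End fixed_partition.
End elementary_integral.

Section tail.
Context d {T : measurableType d} {R : realType} {P : probability T R}.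
Context {F : R -> set (set T)} (hF : usual_filtration P F).
Context {W : R -> T -> R} (hW : brownian_motion P F W).
Variables (v : nat -> R) (hv0 : 0 <= v 0) (hv : {homo v : i j / (i <= j)%N >-> i <= j}).

(** The energy up to and including step i is known at time v_i, because it only
    involves the coefficients g_0, ..., g_i: the truncation stays adapted. *)
Let truncation (g : nat -> T -> R) (dl : R) i w :=
  g i w * \1_[set w' | (elementary_energy v g i.+1 w' <= dl)%R] w.

Let truncationE g dl i w : truncation g dl i w =
  if elementary_energy v g i.+1 w <= dl then g i w else 0.
Proof.
rewrite /truncation indicE; case: ifPn => h.
  by rewrite mem_set// mulr1.
by rewrite memNset ?mulr0//=; exact/negP.
Qed.

Lemma elementary_energy_le (g : nat -> T -> R) k l w : (k <= l)%N ->
  elementary_energy v g k w <= elementary_energy v g l w.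
Proof.
move=> /subnKC <-; elim: (l - k)%N => [|n IH]; first by rewrite addn0.
rewrite addnS /elementary_energy big_ord_recr/=; apply: le_trans IH _.
by rewrite lerDl mulr_ge0 ?sqr_ge0// subr_ge0 hv.
Qed.

Let truncation_energy (g : nat -> T -> R) dl k w : 0 <= dl ->
  elementary_energy v (truncation g dl) k w <= dl.
Proof.
move=> dl0; elim: k => [|k IH]; first by rewrite /elementary_energy big_ord0.
have [h|h] := boolP (elementary_energy v g k.+1 w <= dl); last first.
  rewrite /elementary_energy big_ord_recr/= truncationE (negPf h).
  by rewrite expr0n/= mul0r addr0.
apply: le_trans h; apply: ler_sum => i _.
rewrite ler_wpM2r ?subr_ge0 ?hv// truncationE; case: ifP => // _.
by rewrite expr0n/= sqr_ge0.
Qed.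

(** Truncating g keeps its energy below dl, so that the L2 bound and
    Chebyshev's inequality apply; where the whole energy of g is at most dl,
    the truncation changes nothing. *)
Lemma elementary_integral_tail (g : nat -> T -> R) m K (dl e : R) : 0 <= dl -> 0 < e ->
  (forall i, (i < m)%N -> measurable_wrt (F (v i)) (g i)) ->
  (forall i w, (i < m)%N -> `|g i w| <= K) ->
  (P [set w | (e < `|elementary_integral W v g m w|)%R] <=
   (8 * dl / e ^+ 2)%:E + P [set w | (dl < elementary_energy v g m w)%R])%E.
Proof.
move=> dl0 e0 hg hK.
have v_ge0 i : 0 <= v i by rewrite (le_trans hv0)// hv.
set g' := truncation g dl.
have men i : (i < m)%N -> measurable_wrt (F (v i)) (elementary_energy v g i.+1).
  move=> im; apply: (measurable_wrt_elementary_energy hF hv0 hv) => j ji.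
  by apply: hg; exact: leq_ltn_trans im.
have hg' i : (i < m)%N -> measurable_wrt (F (v i)) (g' i).
  move=> im; apply: measurable_funM; first exact: hg.
  apply: (measurable_wrt_indic hF (v_ge0 i)).
  have -> : [set w | elementary_energy v g i.+1 w <= dl] =
    elementary_energy v g i.+1 @^-1` `]-oo, dl].
    by apply/seteqP; split=> w; rewrite /= in_itv.
  exact: (measurable_wrt_preimage hF (v_ge0 i) (men i im)).
have hK' i w : (i < m)%N -> `|g' i w| <= K.
  move=> im; rewrite /g' truncationE; case: ifP => _; first exact: hK.
  by rewrite normr0; apply: le_trans (hK i w im).
have [_ I2] := elementary_integral_sqr hF hW hv0 hv hg' hK'.
have mI' : measurable_fun [set: T] (elementary_integral W v g' m).
  exact: (measurable_wrt_measurable hF (v_ge0 m)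
    (measurable_wrt_elementary_integral hF hW hv0 hv hg')).
have mI : measurable_fun [set: T] (elementary_integral W v g m).
  exact: (measurable_wrt_measurable hF (v_ge0 m)
    (measurable_wrt_elementary_integral hF hW hv0 hv hg)).
have mE : measurable_fun [set: T] (elementary_energy v g m).
  case: (m) men => [|k] men.
    rewrite (_ : elementary_energy v g 0 = cst 0)//.
    by apply/funext => w; rewrite /elementary_energy big_ord0.
  exact: (measurable_wrt_measurable hF (v_ge0 k) (men k (ltnSn k))).
have mA : measurable [set w | e < `|elementary_integral W v g m w|].
  by apply: measurable_gt_set; exact: measurableT_comp.
have mA' : measurable [set w | e < `|elementary_integral W v g' m w|].
  by apply: measurable_gt_set; exact: measurableT_comp.
have mB := measurable_gt_set dl mE.
apply: (@le_trans _ _ (P ([set w | e < `|elementary_integral W v g' m w|] `|`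
   [set w | dl < elementary_energy v g m w]))).
  apply: le_measure; rewrite ?inE//; first exact: measurableU.
  move=> w /= ew; have [h|h] := leP (elementary_energy v g m w) dl; last by right.
  left; rewrite (_ : elementary_integral W v g' m w = elementary_integral W v g m w)//.
  apply: eq_bigr => i _; rewrite /g' truncationE ifT//.
  by apply: le_trans h; exact: elementary_energy_le.
apply: le_trans (measureU2 _ mA' mB) _.
rewrite leeD2r//; apply: le_trans (measure_sqr_tail P e0 mI') _.
rewrite mulrC EFinM; apply: lee_wpmul2l.
  by rewrite lee_fin invr_ge0 exprn_ge0// ltW.
apply: le_trans I2 _; rewrite EFinM; apply: lee_wpmul2l => //.
apply: (@le_trans _ _ (\int[P]_w dl%:E)%E).
  apply: ge0_le_integral => //.
  - by move=> w _; rewrite lee_fin elementary_energy_ge0.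
  - apply/measurable_EFinP; apply: measurable_sum => i; apply: measurable_funM => //.
    apply: measurable_funX.
    exact: (measurable_wrt_measurable hF (v_ge0 i) (hg' _ (ltn_ord i))).
  - by move=> w _; rewrite lee_fin truncation_energy.
by rewrite integral_cst//= probability_setT mule1.
Qed.

End tail.

(** * Absorption of nonnegative martingales at zero *)

Section grid.
Context {R : realType}.

Lemma grid_dense (t h : R) : 0 <= t -> 0 < h ->
  \forall m \near \oo, exists k : nat, t < k.+1%:R / m.+1%:R < t + h.
Proof.
move=> t0 h0.
have H : \forall m \near \oo, m.+1%:R^-1 < h := near_infty_natSinv_lt (PosNum h0).
apply: filterS H => m mh.
have m0 : 0 < m.+1%:R :> R by [].
exists (Num.truncn (t * m.+1%:R)).
have /andP[tr1 tr2] := truncn_itv (mulr_ge0 t0 (ltW m0)).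
rewrite ltr_pdivlMr// tr2/= ltr_pdivrMr// mulrDl -natr1 ler_ltD//.
by rewrite -ltr_pdivrMr// div1r.
Qed.

End grid.

Section liminf.
Context d {T : measurableType d} {R : realType}.
Variable mu : {measure set T -> \bar R}.

Lemma measure_liminf_le (B : nat -> set T) (c : \bar R) :
  (forall n, measurable (B n)) -> (forall n, mu (B n) <= c)%E ->
  measurable (\bigcup_N \bigcap_(n >= N) B n) /\
  (mu (\bigcup_N \bigcap_(n >= N) B n) <= c)%E.
Proof.
move=> mB Bc.
have mG N : measurable (\bigcap_(n >= N) B n).
  by apply: bigcap_measurable => //; exists N => /=.
have mU : measurable (\bigcup_N \bigcap_(n >= N) B n) by exact: bigcup_measurable.
split => //.
have nd : nondecreasing_seq (fun N => \bigcap_(n >= N) B n).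
  move=> i j ij; apply/subsetPset => w Bw n /= jn; apply: Bw => /=.
  exact: leq_trans jn.
have cv := nondecreasing_cvg_mu (mu := mu) mG mU nd.
rewrite -(cvg_lim _ cv)//; apply: lime_le; first by apply/cvg_ex; eexists; exact: cv.
apply: nearW => N /=; apply: le_trans (Bc N).
by apply: le_measure; rewrite ?inE// => w; apply => /=.
Qed.

End liminf.

Section absorption.
Context d {T : measurableType d} {R : realType} {P : probability T R}.
Context {F : R -> set (set T)} (hF : usual_filtration P F).
Context {Z : R -> T -> R} (hZ : martingale P F Z).
Hypothesis Z0 : forall t w, 0 <= t -> 0 <= Z t w.

Let measZ t : 0 <= t -> measurable_fun [set: T] (Z t).
Proof.
by move=> t0; apply: (measurable_wrt_measurable hF t0); exact: (martingale_adapted hZ).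
Qed.

Let low (s : nat -> R) (e : R) n : set T :=
  [set w | exists2 k, (k < n)%N & Z (s k) w < e].

Let lowS s e n : low s e n.+1 = low s e n `|` [set w | Z (s n) w < e].
Proof.
apply/seteqP; split=> w /=.
  move=> [k]; rewrite ltnS leq_eqVlt => /predU1P[-> ?|kn ?]; first by right.
  by left; exists k.
by move=> [[k kn ?]|?]; [exists k => //; exact: ltnW|exists n].
Qed.

Let low_filtration s e n t : (forall k, 0 <= s k) ->
  (forall k, (k < n)%N -> s k <= t) -> 0 <= t -> F t (low s e n).
Proof.
move=> s0 st t0.
rewrite -(measurable_g_measurableTypeE (filtration_sigma_algebra hF t0)).
elim: n st => [|n IH] st.
  by rewrite (_ : low s e 0 = set0)// -subset0 => w [].
rewrite lowS; apply: measurableU.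
  by apply: IH => k kn; apply: st; rewrite ltnS ltnW.
rewrite (_ : [set w | _] = Z (s n) @^-1` `]-oo, e[); last first.
  by apply/seteqP; split=> w; rewrite /= in_itv.
rewrite (measurable_g_measurableTypeE (filtration_sigma_algebra hF t0)).
apply: (measurable_wrt_preimage hF t0) => //.
apply: (measurable_wrt_le hF (s0 n) (st n (ltnSn n))).
exact: (martingale_adapted hZ).
Qed.

Let measurable_low s e n : (forall k, 0 <= s k) ->
  {homo s : i j / (i <= j)%N >-> i <= j} -> measurable (low s e n).
Proof.
move=> s0 sh; apply: (filtration_measurable hF (s0 n)).
by apply: low_filtration => // k kn; apply: sh; exact: ltnW.
Qed.

(** At the first k with Z_(s_k) < e, an event of F_(s_k), the martingale property
    replaces Z_q by Z_(s_k) < e under the integral. *)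
Lemma integral_low (s : nat -> R) (e q : R) n : 0 < e -> (forall k, 0 <= s k) ->
  {homo s : i j / (i <= j)%N >-> i <= j} -> (forall k, (k < n)%N -> s k <= q) ->
  (\int[P]_(w in low s e n) (Z q w)%:E <= e%:E * P (low s e n))%E.
Proof.
move=> e0 s0 sh; elim: n => [|n IH] sq.
  by rewrite (_ : low s e 0 = set0) ?integral_set0 ?measure0 ?mule0// -subset0 => w [].
have snq := sq n (ltnSn n).
have q0 : 0 <= q := le_trans (s0 n) snq.
pose A := low s e n.+1 `\` low s e n.
have FA : F (s n) A.
  have FE := measurable_g_measurableTypeE (filtration_sigma_algebra hF (s0 n)).
  rewrite -FE; apply: measurableD; rewrite FE;
    by apply: low_filtration => // k; rewrite ?ltnS => kn; apply: sh => //; exact: ltnW.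
have mA : measurable A := filtration_measurable hF (s0 n) FA.
have ml := measurable_low e n s0 sh.
have sub : low s e n `<=` low s e n.+1 by rewrite lowS => w; left.
have -> : low s e n.+1 = low s e n `|` A by rewrite /A setDUK.
have dis : low s e n `&` A = set0 by rewrite /A setDIK.
have mZ : measurable_fun [set: T] (EFin \o Z q) by apply/measurable_EFinP; exact: measZ.
rewrite ge0_integral_setU//; last 3 first.
- exact: measurable_funTS.
- by move=> w _; rewrite lee_fin Z0.
- by rewrite disj_set2E dis.
rewrite measureU// ge0_muleDr//; apply: leeD.
  by apply: IH => k kn; apply: sq; rewrite ltnS ltnW.
have [_ _ <-//] := martingale_condexp hZ (s0 n) snq.
rewrite -integral_cst//; apply: ge0_le_integral => //.
- by move=> w _; rewrite lee_fin Z0.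
- by apply/measurable_funTS/measurable_EFinP; exact: measZ.
- by rewrite /A lowS => w [[//|/= /ltW]]; rewrite lee_fin.
Qed.

(** Once Z vanishes before q, right-continuity puts it below e on a whole
    interval before q, which every fine enough grid meets. Hence the event lies
    in the limit inferior of events of probability at most e / a. *)
Lemma negligible_rebound (q a : R) : 0 < q -> 0 < a ->
  P.-negligible [set w | a <= Z q w /\ exists2 s, 0 <= s < q & Z s w = 0].
Proof.
move=> q0 a0.
pose s n k : R := k%:R / n.+1%:R * q.
have s0 n k : 0 <= s n k by rewrite mulr_ge0 ?(ltW q0)// divr_ge0.
have sh n : {homo s n : i j / (i <= j)%N >-> i <= j}.
  by move=> i j ij; rewrite ler_pM2r// ler_pM2r ?invr_gt0// ler_nat.
have sq n k : (k < n.+1)%N -> s n k <= q.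
  move=> kn; rewrite ler_piMl ?(ltW q0)// ler_pdivrMr// mul1r ler_nat.
  exact: ltnW.
pose B e n := low (s n) e n.+1 `&` [set w | (a%:E <= `|(Z q w)%:E|)%E].
have mZq : measurable_fun [set: T] (EFin \o Z q).
  by apply/measurable_EFinP; exact/measZ/ltW.
have mB e n : measurable (B e n).
  apply: emeasurable_fun_c_infty; first exact: measurable_low.
  by apply: measurable_funTS; exact: measurableT_comp.
have PB e n : 0 < e -> (P (B e n) <= (e / a)%:E)%E.
  move=> e0; rewrite EFinM lee_pdivlMr// muleC.
  have mlow := measurable_low e n.+1 (s0 n) (sh n).
  have := le_integral_abse P mlow (measurable_funTS mZq) a0.
  move=> /le_trans; apply.
  under eq_integral do rewrite gee0_abs ?lee_fin ?Z0 ?(ltW q0)//.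
  apply: le_trans (integral_low e0 (s0 n) (sh n) (sq n)) _.
  rewrite -[leRHS]mule1; apply: lee_wpmul2l; first by rewrite lee_fin ltW.
  exact: probability_le1.
pose L e := \bigcup_N \bigcap_(n >= N) B e n.
have mL e : 0 < e -> measurable (L e).
  by move=> e0; have [] := measure_liminf_le (mB e) (PB e ^~ e0).
have PL e : 0 < e -> (P (L e) <= (e / a)%:E)%E.
  by move=> e0; have [] := measure_liminf_le (mB e) (PB e ^~ e0).
exists (\bigcap_n L n.+1%:R^-1); split.
- by apply: bigcap_measurable => // n _; apply: mL; rewrite invr_gt0.
- apply/eqP; rewrite eq_le measure_ge0 andbT; apply/lee_addgt0Pr => e e0.
  rewrite add0e.
  have ea0 : 0 < e * a by rewrite mulr_gt0.
  have [n _ /(_ n (leqnn n)) /= ne] := near_infty_natSinv_lt (PosNum ea0).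
  have n0 : 0 < n.+1%:R^-1 :> R by rewrite invr_gt0.
  apply: (@le_trans _ _ (P (L n.+1%:R^-1))).
    apply: le_measure; rewrite ?inE; last by move=> w; exact.
      by apply: bigcap_measurable => // k _; apply: mL; rewrite invr_gt0.
    exact: mL.
  apply: le_trans (PL _ n0) _; rewrite lee_fin ler_pdivrMr//.
  exact: ltW.
- move=> w [aZ [t /andP[t0 tq] Zt]] m _.
  set e := m.+1%:R^-1.
  have e0 : 0 < e by rewrite invr_gt0.
  have /(_ w t t0) := @martingale_right_continuous _ _ _ _ _ _ hZ.
  rewrite Zt => /cvgr_lt/(_ _ e0) [h /= h0 Zh].
  have h'0 : 0 < Num.min h (q - t) by rewrite lt_min h0 subr_gt0.
  have := @grid_dense R (t / q) (Num.min h (q - t) / q).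
  rewrite divr_ge0 ?(ltW q0)// divr_gt0// => /(_ isT isT) [N _ HN].
  exists N => // n /= Nn; have [k /andP[k1 k2]] := HN n Nn.
  split => /=; last by rewrite lee_fin ger0_norm// Z0// ltW.
  have tk : t < s n k.+1 by rewrite /s -ltr_pdivrMr.
  have kt : s n k.+1 < t + Num.min h (q - t).
    by rewrite /s -ltr_pdivlMr// mulrDl.
  exists k.+1.
    have : s n k.+1 < q.
      apply: lt_le_trans kt _.
      by rewrite -lerBrDl ge_min lexx orbT.
    by rewrite /s gtr_pMl// ltr_pdivrMr// mul1r ltr_nat.
  apply: Zh => //=; rewrite distrC ger0_norm ?subr_ge0 ?(ltW tk)//.
  rewrite ltrBlDl; apply: lt_le_trans kt _.
  by rewrite lerD2l ge_min lexx.
Qed.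

(** If Z_t were positive after a zero, then by right-continuity Z would be above
    some 1 / (j + 1) at a rational time after t, and only countably many
    exceptional null sets have to be discarded. *)
Lemma zero_absorbing : {ae P, forall w, forall s t,
  0 <= s -> s <= t -> Z s w = 0 -> Z t w = 0}.
Proof.
have : {ae P, forall w, forall n m j, ~ (j.+1%:R^-1 <= Z (n.+1%:R / m.+1%:R) w /\
    exists2 s, 0 <= s < n.+1%:R / m.+1%:R & Z s w = 0)}.
  apply/ae_foralln => n; apply/ae_foralln => m; apply/ae_foralln => j.
  have q0 : 0 < n.+1%:R / m.+1%:R :> R by rewrite divr_gt0.
  have j0 : 0 < j.+1%:R^-1 :> R by rewrite invr_gt0.
  apply: negligibleS (negligible_rebound q0 j0) => w /=.
  by move/contrapT.
apply: filterS => w H s t s0 st Zs.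
apply/eqP/negPn/negP => Zt.
have t0 := le_trans s0 st.
have Zt0 : 0 < Z t w by rewrite lt_def Zt Z0.
have /(_ w t t0)/cvgr_gt := @martingale_right_continuous _ _ _ _ _ _ hZ => /(_ _ Zt0).
move=> [h /= h0 Zh].
have [m _ /(_ m (leqnn m)) [k /andP[k1 k2]]] := grid_dense t0 h0.
set q := k.+1%:R / m.+1%:R in k1 k2.
have Zq : 0 < Z q w.
  apply: Zh => //=; rewrite distrC ger0_norm ?subr_ge0 ?(ltW k1)//.
  by rewrite ltrBlDl.
have [j _ /(_ j (leqnn j)) /= jq] := near_infty_natSinv_lt (PosNum Zq).
apply: (H k m j); split; first exact: ltW.
by exists s => //; rewrite s0/= (le_lt_trans st).
Qed.

End absorption.

(** * Simple processes on a subinterval *)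

Section step_integral.
Context {R : realType}.
Local Notation mu := (@lebesgue_measure R).

Lemma integral_step (f : R -> R) (v k : nat -> R) m :
  {homo v : i j / (i <= j)%N >-> i <= j} ->
  measurable_fun `]v 0%N, v m] (EFin \o f) -> (forall r, 0 <= f r) ->
  (forall i r, (i < m)%N -> v i < r <= v i.+1 -> f r = k i) ->
  (\int[mu]_(r in `]v 0%N, v m]) (f r)%:E = (\sum_(i < m) k i * (v i.+1 - v i))%:E)%E.
Proof.
move=> hv; elim: m => [|m IH] mf f0 fk.
  by rewrite big_ord0 set_itv_ge ?integral_set0// bnd_simp ltxx.
have v0m : v 0%N <= v m by rewrite hv.
have vmS : v m <= v m.+1 by rewrite hv.
have U : `]v 0%N, v m.+1]%classic = `]v 0%N, v m] `|` `]v m, v m.+1].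
  by rewrite -itv_bndbnd_setU// bnd_simp.
rewrite U ge0_integral_setU//; last 3 first.
- by rewrite -U.
- by move=> r _; rewrite lee_fin.
- rewrite disj_set2E; apply/eqP; rewrite -subset0 => r /=; rewrite !in_itv/=.
  by move=> [/andP[_ rm] /andP[/lt_le_trans/(_ rm)]]; rewrite ltxx.
rewrite IH//; last 2 first.
- by apply: measurable_funS mf => //; rewrite U => r; left.
- by move=> i r im; apply: fk; rewrite ltnS ltnW.
rewrite big_ord_recr/= EFinD; congr (_ + _)%E.
rewrite (eq_integral (cst (k m)%:E)); last first.
  by move=> r; rewrite inE/= in_itv/= => vr; rewrite (fk m).
rewrite integral_cst//= lebesgue_measure_itv/= lte_fin.
move: vmS; rewrite le_eqVlt => /predU1P[->|vmS].
  by rewrite ltxx mule0 subrr mulr0.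
by rewrite vmS EFinM EFinB.
Qed.

End step_integral.

Section simple_process.
Context d {T : measurableType d} {R : realType}.
Variable S : simple_process T R.
Hypothesis hS : {homo sp_time S : i j / (i <= j)%N >-> i <= j}.
Local Notation n := (sp_size S).
Local Notation u := (sp_time S).
Local Notation xi := (sp_coef S).

Lemma sp_value_in j r w : (j < n)%N -> u j < r <= u j.+1 -> sp_value S r w = xi j w.
Proof.
move=> jn /andP[jr rj].
rewrite /sp_value (bigD1 (Ordinal jn))//= big1 ?addr0.
  by rewrite indicE mem_set ?mulr1//= in_itv/= jr.
move=> i; rewrite -val_eqE/= => ij.
rewrite indicE memNset ?mulr0//= in_itv/= => /andP[ir ri].
move: ij; rewrite neq_ltn => /orP[ij|ij].
  by have := lt_le_trans jr (le_trans ri (hS ij)); rewrite ltxx.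
by have := lt_le_trans ir (le_trans rj (hS ij)); rewrite ltxx.
Qed.

Lemma sp_value_before r w : r <= u 0 -> sp_value S r w = 0.
Proof.
move=> r0; rewrite /sp_value big1// => i _.
rewrite indicE memNset ?mulr0//= in_itv/= => /andP[ir _].
by have := lt_le_trans ir (le_trans r0 (hS (leq0n i))); rewrite ltxx.
Qed.

Lemma sp_value_after r w : u n < r -> sp_value S r w = 0.
Proof.
move=> r0; rewrite /sp_value big1// => i _.
rewrite indicE memNset ?mulr0//= in_itv/= => /andP[_ ri].
by have := lt_le_trans r0 (le_trans ri (hS (ltn_ord i))); rewrite ltxx.
Qed.

Variables (s t : R) (st : s <= t).

Definition clamp x := Num.max s (Num.min x t).

Lemma clamp_homo x y : x <= y -> clamp x <= clamp y.
Proof.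
move=> xy; rewrite /clamp ge_max !le_max lexx/=.
by apply/orP; right; rewrite le_min !ge_min xy lexx orbT.
Qed.

Lemma clamp_ge x : s <= clamp x. Proof. by rewrite le_max lexx. Qed.

Lemma clamp_le x : clamp x <= t.
Proof. by rewrite ge_max st ge_min lexx orbT. Qed.

Lemma clamp_lt x r : s < r <= t -> (clamp x < r) = (x < r).
Proof.
move=> /andP[sr rt]; rewrite /clamp gt_max sr gt_min/=.
by rewrite (ltNge t) rt orbF.
Qed.

Lemma increment_clamp (W : R -> T -> R) x w :
  W (Num.min x t) w - W (Num.min x s) w = W (clamp x) w - W s w.
Proof.
rewrite /clamp; have [xt|tx] := leP x t.
  by have [sx|xs] := leP s x; rewrite ?subrr.
by rewrite (max_r st) min_r// (le_trans st)// ltW.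
Qed.

(** The times of S clamped to [s, t], with s and t themselves added at both
    ends: they cut ]s, t] into intervals on which S is constant, including those
    that precede the first time or follow the last time of S. *)
Definition refined_time i :=
  if i is j.+1 then if (j <= n)%N then clamp (u j) else t else s.

(** The values of S on these intervals. A coefficient whose time exceeds t is
    replaced by 0: its interval is empty after clamping, and it would not be
    measurable at the clamped time. *)
Definition refined_coef i w :=
  if i is j.+1 then if (j < n)%N && (u j <= t) then xi j w else 0 else 0.

Lemma refined_time_homo : {homo refined_time : i j / (i <= j)%N >-> i <= j}.
Proof.
move=> [|i] [|j]//=; first by move=> _; case: ifP => // _; exact: clamp_ge.
rewrite ltnS => ij; case: ifPn => iN; case: ifPn => jN.
- exact/clamp_homo/hS.
- exact: clamp_le.
- by rewrite (leq_trans ij jN) in iN.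
- by [].
Qed.

Lemma refined_coefE i r w : (i < n.+2)%N ->
  refined_time i < r <= refined_time i.+1 -> sp_value S r w = refined_coef i w.
Proof.
move=> iN /andP[ir ri].
have srt : s < r <= t.
  apply/andP; split; first by apply: le_lt_trans ir; exact: (refined_time_homo (leq0n i)).
  by apply: le_trans ri _; rewrite /=; case: ifP => // _; exact: clamp_le.
have clt x := clamp_lt x srt.
have cge x : (r <= clamp x) = (r <= x) by rewrite !leNgt clt.
case: i iN ir ri => [|i] iN; rewrite /refined_time/refined_coef.
  by move=> _; rewrite leq0n cge; exact: sp_value_before.
rewrite ltnS in iN; rewrite -ltnS iN clt; case: ltnP => iN' ir.
  rewrite cge => ri; rewrite (sp_value_in (j := i))// ?ir//.
  by rewrite /= (ltW (lt_le_trans ir (andP srt).2)).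
by move=> _; apply: sp_value_after; rewrite (_ : n = i)//; apply/eqP; rewrite eqn_leq iN'.
Qed.

Lemma refined_integral (W : R -> T -> R) c a w :
  elementary_integral W refined_time (fun i w => a w * (refined_coef i w - c)) n.+2 w =
  a w * (sp_integral S W t w - sp_integral S W s w - c * (W t w - W s w)).
Proof.
rewrite /elementary_integral.
under eq_bigr do rewrite -mulrA mulrBl.
rewrite -mulr_sumr sumrB; congr (_ * (_ - _)); last first.
  rewrite -mulr_sumr; congr (_ * _).
  rewrite -(big_mkord xpredT (fun i => W (refined_time i.+1) w - W (refined_time i) w)).
  by rewrite telescope_sumr//= ltnn.
rewrite big_ord_recl/= mul0r add0r big_ord_recr/= ltnn mul0r addr0.
rewrite /sp_integral -sumrB; apply: eq_bigr => i _.
rewrite -mulrBr /bump/= !add1n (ltn_ord i) (ltnW (ltn_ord i))/=.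
have -> : W (Num.min (u i.+1) t) w - W (Num.min (u i) t) w -
    (W (Num.min (u i.+1) s) w - W (Num.min (u i) s) w) =
  W (clamp (u i.+1)) w - W (clamp (u i)) w.
  have := increment_clamp W (u i.+1) w; have := increment_clamp W (u i) w; lra.
case: ifPn => //; rewrite -ltNge => tu; rewrite mul0r.
have tu' : t <= u i.+1 := le_trans (ltW tu) (hS (leqnSn i)).
by rewrite /clamp (min_r (ltW tu)) (min_r tu') subrr mulr0.
Qed.

Lemma refined_energy (f : R -> R) c (a : T -> R) w :
  measurable_fun `]s, t] (EFin \o f) -> (forall r, 0 <= f r) ->
  (forall r, s < r <= t -> f r = (a w * (sp_value S r w - c)) ^+ 2) ->
  (\int[lebesgue_measure]_(r in `]s, t]) (f r)%:E =
  (elementary_energy refined_time (fun i w => a w * (refined_coef i w - c)) n.+2 w)%:E)%E.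
Proof.
move=> mf f0 fE.
have vt : refined_time n.+2 = t by rewrite /= ltnn.
rewrite -[in LHS]vt.
apply: (@integral_step _ _ _ (fun i => (a w * (refined_coef i w - c)) ^+ 2)
  _ refined_time_homo) => //; first by rewrite vt.
move=> i r iN ir; rewrite fE; first by rewrite (refined_coefE _ iN ir).
have /andP[ir1 ir2] := ir; apply/andP; split.
  exact: le_lt_trans (refined_time_homo (leq0n i)) ir1.
by apply: le_trans ir2 _; rewrite -vt; exact: refined_time_homo.
Qed.

End simple_process.

(** * Ito integrals of locally constant integrands *)

Section sq_integral.
Context d {T : measurableType d} {R : realType} {P : probability T R}.
Context {F : R -> set (set T)} (hF : usual_filtration P F).
Variables (S : simple_process T R) (H : R -> T -> R).
Hypotheses (hS : simple_predictable F S) (hH : progressively_measurable F H).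

Let gap (p : R * T) : R := sp_value S p.1 p.2 - H p.1 p.2.

Let sptime_ge0 i : 0 <= sp_time S i.
Proof. by rewrite (le_trans (simple_time0 hS))// (simple_time_nondecreasing hS). Qed.

Lemma measurable_gap (t : R) : 0 <= t ->
  measurable_fun (`[0, t] `*` [set: T]) gap.
Proof.
move=> t0; apply: measurable_funB.
  apply: measurable_sum => i; apply: measurable_funTS; apply: measurable_funM.
    apply: (measurableT_comp _ measurable_snd).
    apply: (measurable_wrt_measurable hF (sptime_ge0 i)).
    exact: (simple_coef_measurable hS).
  have mI : measurable_fun [set: R] (\1_`]sp_time S i, sp_time S i.+1] : R -> R).
    exact: measurable_indic.
  exact: (measurableT_comp mI measurable_fst).
have mid : measurable_fun [set: T] (id : T -> g_sigma_algebraType (F t)).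
  move=> _ B mB; rewrite setTI preimage_id; apply: (filtration_measurable hF t0).
  by rewrite -(measurable_g_measurableTypeE (filtration_sigma_algebra hF t0)).
have mg : measurable_fun [set: R * T]
    (fun p : R * T => (p.1, p.2) : R * g_sigma_algebraType (F t)).
  apply/measurable_fun_pairP; split; first exact: measurable_fst.
  exact: (measurableT_comp mid measurable_snd).
apply: (measurable_comp _ _ (hH t0) (measurable_funTS mg)).
- by apply: measurableX.
- by move=> _ [p [p1 _] <-].
Qed.

(** Extended by 0 outside [0, t], so that Tonelli's theorem applies on the whole
    product space. *)
Let sqgap (t : R) (p : R * T) : \bar R :=
  ((fun p => (gap p ^+ 2)%:E) \_ (`[0, t] `*` [set: T])) p.

Let measurable_sqgap (t : R) : 0 <= t -> measurable_fun [set: R * T] (sqgap t).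
Proof.
move=> t0; apply/(measurable_restrictT _ _).1.
  exact: measurableX.
by apply/measurable_EFinP; apply: measurable_funX; exact: measurable_gap.
Qed.

Let sqgapE t r w : sqgap t (r, w) = ((fun r => (gap (r, w) ^+ 2)%:E) \_ `[0, t]) r.
Proof.
by rewrite /sqgap !patchE/= in_setX/= in_setT andbT.
Qed.

Lemma measurable_gap_section (t : R) w : 0 <= t ->
  measurable_fun `[0, t] (fun r => ((sp_value S r w - H r w) ^+ 2)%:E).
Proof.
move=> t0; apply/(measurable_restrictT _ _).2 => //.
rewrite (_ : _ \_ _ = (fun r => sqgap t (r, w))); last first.
  by apply/funext => r; rewrite sqgapE.
apply: (measurableT_comp (measurable_sqgap t0)).
exact: measurable_pair2.
Qed.

Lemma measurable_sq_time_integral t : 0 <= t ->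
  measurable_fun [set: T] (sq_time_integral (fun r w => sp_value S r w - H r w) t).
Proof.
move=> t0.
have := @measurable_fun_fubini_tonelli_G _ _ (measurableTypeR R) T R lebesgue_measure
  (sqgap t) (measurable_sqgap t0).
rewrite (_ : fubini_G _ _ = sq_time_integral (fun r w => sp_value S r w - H r w) t).
  by apply=> -[r w]; rewrite sqgapE patchE; case: ifP => // _; rewrite lee_fin sqr_ge0.
apply/funext => w; rewrite /fubini_G /sq_time_integral [RHS]integral_mkcond.
by apply: eq_integral => r _; rewrite sqgapE.
Qed.

End sq_integral.

Section ito_constant.
Context d {T : measurableType d} {R : realType} {P : probability T R}.
Context {F : R -> set (set T)} (hF : usual_filtration P F).
Context {W : R -> T -> R} (hW : brownian_motion P F W).

Lemma measurable_sp_integral (S : simple_process T R) t : simple_predictable F S ->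
  0 <= t -> measurable_fun [set: T] (sp_integral S W t).
Proof.
move=> hS t0.
have u0 i : 0 <= sp_time S i.
  by rewrite (le_trans (simple_time0 hS))// (simple_time_nondecreasing hS).
apply: measurable_sum => i; apply: measurable_funM.
  exact: (measurable_wrt_measurable hF (u0 i) (simple_coef_measurable hS (ltn_ord i))).
by apply: measurable_funB; apply: (measurable_brownian hF hW); rewrite le_min u0.
Qed.

Section simple_approximation.
Variables (S : simple_process T R) (hS : simple_predictable F S).
Variables (H : R -> T -> R) (hH : progressively_measurable F H).
Variables (s t c : R) (s0 : 0 <= s) (st : s < t) (A : set T) (FA : F s A).
Hypothesis HA : forall w r, A w -> s < r <= t -> H r w = c.

Let t0 : 0 <= t. Proof. by rewrite (le_trans s0)// ltW. Qed.

Let hSt := simple_time_nondecreasing hS.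

Let v := refined_time S s t.
Let g i w : R := \1_A w * (refined_coef S t i w - c).

Let v0 : 0 <= v 0%N. Proof. by []. Qed.

Let vh : {homo v : i j / (i <= j)%N >-> i <= j}.
Proof. exact: (refined_time_homo hSt (ltW st)). Qed.

Let v_ge i : s <= v i. Proof. exact: (vh (leq0n i)). Qed.

Let v_ge0 i : 0 <= v i. Proof. by rewrite (le_trans s0). Qed.

Let adapted_coef i : measurable_wrt (F (v i)) (g i).
Proof.
have mA : measurable_wrt (F (v i)) (\1_A : T -> R).
  exact: (measurable_wrt_le hF s0 (v_ge i) (measurable_wrt_indic hF s0 FA)).
apply: measurable_funM => //; apply: measurable_funB => //.
case: i {mA} => [|i]; first exact: measurable_cst.
rewrite (_ : refined_coef S t i.+1 =
    if (i < sp_size S)%N && (sp_time S i <= t) then sp_coef S i else cst 0); last first.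
  by apply/funext => w /=; case: ifP.
case: ifPn => [/andP[iS it]|_]; last exact: measurable_cst.
have u0 : 0 <= sp_time S i.
  by rewrite (le_trans (simple_time0 hS))// hSt.
apply: (measurable_wrt_le hF u0 _ (simple_coef_measurable hS iS)).
by rewrite /v /= (ltnW iS) /clamp le_max (min_l it) lexx orbT.
Qed.

Let bounded_coef : exists K, forall i w, `|g i w| <= K.
Proof.
have [M HM] := simple_coef_bounded hS.
exists (`|M| + `|c|) => i w.
rewrite /g normrM; apply: (@le_trans _ _ `|refined_coef S t i w - c|).
  rewrite ler_piMl// indicE; case: (_ \in _) => /=; rewrite ?normr1 ?normr0//.
apply: le_trans (ler_normB _ _) _; rewrite lerD2r.
case: i => [|i] /=; first by rewrite normr0.
case: ifPn => [/andP[iS _]|_]; last by rewrite normr0.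
by apply: le_trans (HM _ _ iS) _; rewrite ler_norm.
Qed.

Let energy_le w : ((elementary_energy v g (sp_size S).+2 w)%:E <=
  sq_time_integral (fun r w => (sp_value S r w - H r w)%R) t w)%E.
Proof.
have mgap := measurable_gap_section hF hS hH w t0.
have sub : `]s, t]%classic `<=` `[0, t]%classic.
  move=> r /=; rewrite !in_itv/= => /andP[sr ->]; rewrite andbT.
  by rewrite (le_trans s0)// ltW.
have [Aw|nAw] := pselect (A w); last first.
  rewrite (_ : elementary_energy _ _ _ _ = 0).
    by apply: integral_ge0 => r _; rewrite lee_fin sqr_ge0.
  rewrite /elementary_energy big1// => i _.
  by rewrite /g indicE memNset//= mul0r expr0n/= mul0r.
rewrite -(refined_energy hSt (ltW st) (f := fun r => (sp_value S r w - H r w) ^+ 2)).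
- apply: ge0_subset_integral => //.
  by move=> r _; rewrite lee_fin sqr_ge0.
- exact: measurable_funS mgap.
- by move=> r; exact: sqr_ge0.
- by move=> r srt; rewrite (HA Aw srt) indicE mem_set// mul1r.
Qed.


(** The process 1_A (S - c) on ]s, t] is elementary because A belongs to F_s, and
    its energy is at most the squared distance between S and H, as H = c on
    A. *)
Lemma simple_gap_tail (e dl : R) : 0 < e -> 0 <= dl ->
  (P (A `&` [set w | (e < `|sp_integral S W t w - sp_integral S W s w
                            - c * (W t w - W s w)|)%R]) <=
   (8 * dl / e ^+ 2)%:E +
   P [set w | dl%:E < sq_time_integral (fun r w => (sp_value S r w - H r w)%R) t w])%E.
Proof.
move=> e0 dl0; have [K gK] := bounded_coef.
have := @elementary_integral_tail _ _ _ _ _ hF _ hW v v0 vh g (sp_size S).+2 K dl e dl0 e0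
  (fun i _ => @adapted_coef i) (fun i w _ => gK i w).
have mA : measurable A := filtration_measurable hF s0 FA.
have mei : measurable_fun [set: T] (elementary_integral W v g (sp_size S).+2).
  exact: (measurable_wrt_measurable hF (v_ge0 _)
    (measurable_wrt_elementary_integral hF hW v0 vh (fun i _ => @adapted_coef i))).
have men : measurable_fun [set: T] (elementary_energy v g (sp_size S).+2).
  exact: (measurable_wrt_measurable hF (v_ge0 _)
    (measurable_wrt_elementary_energy hF v0 vh (fun i _ => @adapted_coef i))).
have mW r : 0 <= r -> measurable_fun [set: T] (W r) := measurable_brownian hF hW (t := r).
move=> tail; apply: le_trans (le_trans _ tail) _.
- apply: le_measure; rewrite ?inE.
  + apply: measurableI => //; apply: measurable_gt_set.
    apply: measurableT_comp => //; apply: measurable_funB.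
      by apply: measurable_funB; exact: measurable_sp_integral.
    by apply: measurable_funM => //; apply: measurable_funB; exact: mW.
  + by apply: measurable_gt_set; exact: measurableT_comp.
  + move=> w [Aw]; rewrite /= /v /g.
    have := refined_integral hSt (ltW st) W c \1_A w.
    by rewrite indicE mem_set// mul1r => ->.
- apply: leeD2l; apply: le_measure; rewrite ?inE.
  + exact: measurable_gt_set.
  + rewrite -[X in measurable X]setTI.
    apply: emeasurable_fun_o_infty => //.
    exact: (measurable_sq_time_integral hF hS hH t0).
  + by move=> w /= en; apply: lt_le_trans (energy_le w); rewrite lte_fin.
Qed.

End simple_approximation.

(** The increment of I between s and t is the limit in probability of the
    increments of the simple integrals, and on A the latter converge to
    c * (W_t - W_s) by [simple_gap_tail]. *)
Lemma ito_integral_constant (H I : R -> T -> R) (s t c : R) (A : set T) :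
  is_ito_integral P F W H I -> 0 <= s -> s < t -> F s A ->
  (forall w r, A w -> s < r <= t -> H r w = c) ->
  P.-negligible (A `&` [set w | I t w - I s w != c * (W t w - W s w)]).
Proof.
move=> hI s0 st FA HA.
have t0 : 0 <= t by rewrite (le_trans s0)// ltW.
have mA : measurable A := filtration_measurable hF s0 FA.
have mI r : 0 <= r -> measurable_fun [set: T] (I r).
  by move=> r0; apply: (measurable_wrt_measurable hF r0); exact: (ito_adapted hI).
have mW r : 0 <= r -> measurable_fun [set: T] (W r) := measurable_brownian hF hW (t := r).
have [S [hS cvH cvI]] := ito_approximation hI.
pose Y w := I t w - I s w - c * (W t w - W s w).
have mY : measurable_fun [set: T] Y.
  apply: measurable_funB; first by apply: measurable_funB; exact: mI.
  by apply: measurable_funM => //; apply: measurable_funB; exact: mW.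
pose B e := A `&` [set w | e < `|Y w|].
have mB e : measurable (B e).
  by apply: measurableI => //; apply: measurable_gt_set; exact: measurableT_comp.
pose far r e n := [set w | e < `|sp_integral (S n) W r w - I r w|].
have mfar r e n : 0 <= r -> measurable (far r e n).
  move=> r0; apply: measurable_gt_set; apply: measurableT_comp => //.
  by apply: measurable_funB; [exact: measurable_sp_integral|exact: mI].
pose gap dl n := [set w |
  (dl%:E < sq_time_integral (fun r w => (sp_value (S n) r w - H r w)%R) t w)%E].
(* The threshold 3 e is shared between the approximation of I_t, that of I_s, and
   the simple integral of S_n - c. *)
have PB e : 0 < e -> P (B (e *+ 3)) = 0%E.
  move=> e0; apply/eqP; rewrite eq_le measure_ge0 andbT; apply/lee_addgt0Pr => x x0.
  rewrite add0e.
  (* chosen so that the first term of the tail estimate is x *)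
  pose dl := x * e ^+ 2 / 8.
  have dl0 : 0 < dl by rewrite divr_gt0// mulr_gt0// exprn_gt0.
  have cv : (P (far t e n) + P (far s e n) + (x%:E + P (gap dl n)))%E @[n --> \oo]
     --> (0 + 0 + (x%:E + 0))%E.
    apply: cvgeD => //; first by apply: cvgeD => //; [exact: cvI|exact: cvI].
    apply: cvgeD => //; first exact: cvg_cst.
    exact: cvH.
  rewrite !add0e adde0 in cv; rewrite -(cvg_lim _ cv)//.
  apply: lime_ge; first by apply/cvg_ex; eexists; exact: cv.
  apply: nearW => n.
  have tail := simple_gap_tail (hS n) (ito_progressive hI) s0 st FA HA e0 (ltW dl0).
  have xE : 8 * dl / e ^+ 2 = x by rewrite /dl; field; rewrite gt_eqF.
  rewrite xE in tail.
  set C := _ `&` _ in tail.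
  have mC : measurable C.
    apply: measurableI => //; apply: measurable_gt_set; apply: measurableT_comp => //.
    apply: measurable_funB.
      by apply: measurable_funB; exact: measurable_sp_integral.
    by apply: measurable_funM => //; apply: measurable_funB; exact: mW.
  apply: (@le_trans _ _ (P (far t e n `|` far s e n `|` C))).
    apply: le_measure; rewrite ?inE//.
      by apply: measurableU => //; apply: measurableU; exact: mfar.
    move=> w [Aw /= Yw].
    have [|h1] := ltP e `|sp_integral (S n) W t w - I t w|; first by left; left.
    have [|h2] := ltP e `|sp_integral (S n) W s w - I s w|; first by left; right.
    right; split => //=; move: Yw; apply: contraTT; rewrite -!leNgt => h3.
    have -> : Y w = - (sp_integral (S n) W t w - I t w) +
      (sp_integral (S n) W s w - I s w) + (sp_integral (S n) W t w -
      sp_integral (S n) W s w - c * (W t w - W s w)) by rewrite /Y; ring.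
    rewrite mulrS mulr2n addrA; apply: le_trans (ler_normD _ _) (lerD _ h3).
    by apply: le_trans (ler_normD _ _) (lerD _ h2); rewrite normrN.
  apply: le_trans (measureU2 _ _ mC) _; first by apply: measurableU; exact: mfar.
  apply: leeD => //; apply: measureU2; exact: mfar.
have U : A `&` [set w | I t w - I s w != c * (W t w - W s w)] `<=`
    \bigcup_k B (k.+1%:R^-1 *+ 3).
  move=> w [Aw /=]; rewrite -subr_eq0 -normr_gt0 -/(Y w) => Y0.
  have Y3 : 0 < `|Y w| / 3 by rewrite divr_gt0.
  have [k _ /(_ k (leqnn k)) /= kY] := near_infty_natSinv_lt (PosNum Y3).
  by exists k => //; split => //=; rewrite -[ltLHS]mulr_natr -ltr_pdivlMr.
apply: negligibleS U _; apply: negligible_bigcup => k.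
by exists (B (k.+1%:R^-1 *+ 3)); split => //; apply: PB; rewrite invr_gt0.
Qed.

End ito_constant.

(** * Absorption at the boundary *)

Section boundary.
Context d {T : measurableType d} {R : realType} {P : probability T R}.
Context {F : R -> set (set T)} (hF : usual_filtration P F).
Context {Z : R -> T -> R} (hZ : martingale P F Z).

Lemma martingale_onem : martingale P F (fun t w => 1 - Z t w).
Proof.
have i1 : P.-integrable setT (EFin \o (fun=> 1 : R)).
  exact: finite_measure_integrable_cst.
have iZ t : 0 <= t -> P.-integrable setT (EFin \o Z t) := martingale_integrable hZ (t := t).
have iB t : 0 <= t -> P.-integrable setT (EFin \o (fun w => 1 - Z t w)).
  move=> t0; rewrite (_ : _ \o _ = (fun w => ((1%R : R)%:E - (Z t w)%:E)%E))//.
  exact: (integrableB measurableT i1 (iZ t t0)).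
have adB : adapted F (fun t w => 1 - Z t w).
  by move=> t t0; apply: measurable_funB => //; exact: (martingale_adapted hZ).
split => //.
- move=> s t s0 st; split; [exact: adB|exact: iB|] => A FA.
  have t0 := le_trans s0 st.
  have mA := filtration_measurable hF s0 FA.
  have [_ _ /(_ A FA) ZA] := martingale_condexp hZ s0 st.
  have iA (f : T -> \bar R) : P.-integrable setT f -> P.-integrable A f.
    by apply: integrableS.
  under eq_integral do rewrite EFinB.
  under [RHS]eq_integral do rewrite EFinB.
  rewrite (integralB mA (iA _ i1) (iA _ (iZ _ s0))).
  by rewrite (integralB mA (iA _ i1) (iA _ (iZ _ t0))) ZA.
- move=> w t t0; apply: cvgB; first exact: cvg_cst.
  exact: (@martingale_right_continuous _ _ _ _ _ _ hZ).
Qed.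

(** The infimum defining the hitting time need not be compared with a value of
    Z at that time: if Z_t <> b, then Z avoids b just after t as well, so a visit
    to b must occur before t. *)
Lemma hitting_time_absorbed (b : R) w t :
  (forall r, 0 <= r -> Z r w = b -> forall t', r <= t' -> Z t' w = b) ->
  (hitting_time Z b w <= t%:E)%E -> Z t w = b.
Proof.
move=> abs ht.
have t0 : 0 <= t.
  rewrite -lee_fin; apply: le_trans ht; apply: le_ereal_inf_tmp => _ [r [r0 _] <-].
  by rewrite lee_fin.
apply/eqP/negPn/negP => Zt.
have d0 : 0 < `|Z t w - b| by rewrite normr_gt0 subr_eq0.
have /(_ w t t0)/cvgrPdist_lt/(_ _ d0) := @martingale_right_continuous _ _ _ _ _ _ hZ.
move=> [h /= h0 Zh].
have : (hitting_time Z b w < (t + h)%:E)%E.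
  by apply: le_lt_trans ht _; rewrite lte_fin ltrDl.
move=> /ereal_inf_lt[_ [r [r0 Zr] <-]]; rewrite lte_fin => rth.
have [rt|tr] := leP r t.
  by move: Zt; rewrite (abs r r0 Zr t rt) eqxx.
have := Zh r; rewrite /= Zr ltxx distrC ger0_norm ?subr_ge0 ?(ltW tr)// ltrBlDl rth.
by move=> /(_ isT tr).
Qed.

Hypothesis Z01 : forall t w, 0 <= t -> 0 <= Z t w <= 1.

Lemma boundary_absorbing (b : R) : b = 0 \/ b = 1 ->
  {ae P, forall w, forall r, 0 <= r -> Z r w = b -> forall t, r <= t -> Z t w = b}.
Proof.
move=> [->|->].
  have Z0 t w : 0 <= t -> 0 <= Z t w by move=> /(Z01 w)/andP[].
  by apply: filterS (zero_absorbing hF hZ Z0) => w H r r0 Zr t rt; exact: H Zr.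
have Z0 t w : 0 <= t -> 0 <= 1 - Z t w.
  by move=> /(Z01 w)/andP[_]; rewrite subr_ge0.
apply: filterS (zero_absorbing hF martingale_onem Z0) => w H r r0 Zr t rt.
by apply/esym/eqP; rewrite -subr_eq0; apply/eqP; apply: H rt _ => //; rewrite Zr subrr.
Qed.

End boundary.

Unset Implicit Arguments.

Theorem lemma1 (R : realType) (d : measure_display) (T : measurableType d)
  (P : probability T R) (F : R -> set (set T)) (Z : R -> T -> R) (b : R)
  (hF : usual_filtration P F) (hZ : martingale P F Z)
  (hZ01 : forall (t : R) (w : T), 0 <= t -> 0 <= Z t w <= 1)
  (hb : b = 0 \/ b = 1) :
  {ae P, forall w, (hitting_time Z b w < +oo)%E ->
     forall t : R, (hitting_time Z b w <= t%:E)%E -> Z t w = b}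
  /\
  (forall (W : R -> T -> R) (sigma : R -> R),
     brownian_motion P F W -> solves_sde P F W sigma Z ->
     (0 < P [set w | hitting_time Z b w < +oo])%E ->
     sigma b = 0).
Proof.
have abs := boundary_absorbing hF hZ hZ01 hb.
split.
  by apply: filterS abs => w absw _ t; exact: (hitting_time_absorbed hZ).
move=> W sigma hW [_ _ hI] hit.
apply/eqP/negPn/negP => sb0.
pose N := ~` [set w | forall r, 0 <= r -> Z r w = b -> forall t, r <= t -> Z t w = b].
have negN : P.-negligible N := abs.
have FN n : F n%:R N.
  have n0 : 0 <= n%:R :> R by [].
  exact: (filtration_nondecreasing hF (lexx 0) n0 (filtration_complete hF negN)).
have mN : measurable N := filtration_measurable hF (lexx 0) (FN 0%N).
have PN : P N = 0%E by exact/negligibleP.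
have mZb n : F n%:R [set w | Z n%:R w = b].
  have n0 : 0 <= n%:R :> R by [].
  have := measurable_wrt_preimage hF n0 (martingale_adapted hZ n0) (measurable_set1 b).
  exact.
(* Up to a null set, b is reached if and only if Z_n = b for some integer n, so
   absorption replaces the random hitting time by a deterministic one. *)
have [n Pn] : exists n, (0 < P [set w | Z n%:R w = b])%E.
  apply/not_existsP => Pn; move: hit; apply/negP; rewrite -leNgt.
  have E0 : P.-negligible [set w | (hitting_time Z b w < +oo)%E].
    apply: (@negligibleS _ _ _ _ (N `|` \bigcup_n [set w | Z n%:R w = b])).
      move=> w /= hw; have [|absw] := pselect (N w); [by left|right].
      move: hw; rewrite /hitting_time => /ereal_inf_lt[_ [r [r0 Zr] <-]] _.
      exists (Num.truncn r).+1 => //=.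
      move/contrapT : absw => /(_ r r0 Zr); apply.
      by have /andP[_ /ltW] := truncn_itv r0.
    apply: negligibleU => //; apply: negligible_bigcup => n.
    apply/negligibleP.
      exact: (filtration_measurable hF _ (mZb n)).
    by apply/eqP; rewrite eq_le measure_ge0 andbT leNgt; exact/negP/Pn.
  have mE := filtration_measurable hF (lexx 0) (filtration_complete hF E0).
  by rewrite (negligibleP _ mE).1.
set s : R := n%:R; pose t : R := s + 1.
have s0 : 0 <= s by [].
have st : s < t by rewrite ltrDl.
pose A := [set w | Z s w = b] `\` N.
have FA : F s A.
  have FE := measurable_g_measurableTypeE (filtration_sigma_algebra hF s0).
  rewrite -FE; apply: measurableD; rewrite FE.
  - exact: mZb.
  - exact: FN.
have mA := filtration_measurable hF s0 FA.
(* N is null, so removing it from [Z_s = b] does not change the probability; by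
   completeness of the filtration it does not affect measurability either. *)
have PA : (0 < P A)%E.
  apply: lt_le_trans Pn _; rewrite -[leRHS]adde0 -PN.
  apply: le_trans (measureU2 P mA mN); apply: le_measure; rewrite ?inE.
  - exact: (filtration_measurable hF s0 (mZb n)).
  - exact: measurableU.
  - by move=> w Zw; have [|] := pselect (N w); [right|left].
have Zb w r : A w -> s <= r -> Z r w = b.
  by move=> [/= Zs /contrapT absw] sr; exact: (absw s s0 Zs).
have H w r : A w -> s < r <= t -> sigma (Z r w) = sigma b.
  by move=> Aw /andP[/ltW sr _]; rewrite Zb.
have neg := ito_integral_constant hF hW hI s0 st FA H.
have D0 : measurable (~` [set 0 : R]) by apply: measurableC; exact: measurable_set1.
have mD := measurable_increment hF hW s0 st.
have := brownian_independent hW s0 st FA D0.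
rewrite (brownian_gaussian hW s0 st D0) probability_setC; last exact: measurable_set1.
rewrite [X in (1 - X)%E](normal_prob_set1 _ 0) sube0 mule1.
rewrite (_ : P _ = 0%E); first by move=> A0; rewrite -A0 ltxx in PA.
apply/negligibleP.
  by apply: measurableI => //; rewrite -[_ @^-1` _]setTI; exact: mD.
apply: negligibleS neg => w [Aw /= Dw]; split => //=.
rewrite (Zb w t Aw (ltW st)) (Zb w s Aw (lexx s)).
by rewrite subrr eq_sym mulf_neq0//; apply/eqP.
Qed.
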